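(* Let $0<l_2\le l_1$ be real numbers. For any $x$ with $0<x<\infty$ there exists a unique triangle $ABC$ with $l_a=l_2$, $l_b=l_1$ and $l_c=x$.
   Context: For a non-degenerate triangle $ABC$ in the Euclidean plane, $l_a,l_b,l_c$ denote the lengths of the internal angle bisectors drawn from $A$, $B$, $C$ respectively, measured from the vertex to the opposite side. Uniqueness of triangles is understood up to congruence respecting the vertex labels. *)

(* Defs.v *)
From Stdlib Require Import Reals.
Open Scope R_scope.

Definition point : Type := (R * R)%type.

Definition point_dist (P Q : point) : R := dist_euc (fst P) (snd P) (fst Q) (snd Q).

Definition collinear (P Q S : point) : Prop :=
  exists a b c : R,
    (a <> 0 \/ b <> 0) /\
    a * fst P + b * snd P = c /\
    a * fst Q + b * snd Q = c /\
    a * fst S + b * snd S = c.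

Record plane_triangle : Type := PlaneTriangle {
  vertexA : point;
  vertexB : point;
  vertexC : point;
  nondegenerate : ~ collinear vertexA vertexB vertexC
}.

(* Unoriented angle PVQ, in [0, PI]; meaningful only for P <> V and Q <> V. *)
Definition angle (P V Q : point) : R :=
  acos (((fst P - fst V) * (fst Q - fst V) + (snd P - snd V) * (snd Q - snd V))
        / (point_dist P V * point_dist Q V)).

Definition on_segment (D P Q : point) : Prop :=
  exists t : R, 0 <= t <= 1 /\
    fst D = (1 - t) * fst P + t * fst Q /\
    snd D = (1 - t) * snd P + t * snd Q.

(* Since D is on the side PQ, the bisector VD is the internal one. For V, P, Q
   not collinear, D <> V automatically, so both angles are meaningful. *)
Definition bisector_foot (V P Q D : point) : Prop :=
  on_segment D P Q /\ angle P V D = angle D V Q.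

(* The foot is unique when V, P, Q are not collinear, so this relation
   determines l. *)
Definition bisector_length (V P Q : point) (l : R) : Prop :=
  exists D : point, bisector_foot V P Q D /\ point_dist V D = l.

Definition has_bisectors (T : plane_triangle) (la lb lc : R) : Prop :=
  bisector_length (vertexA T) (vertexB T) (vertexC T) la /\
  bisector_length (vertexB T) (vertexC T) (vertexA T) lb /\
  bisector_length (vertexC T) (vertexA T) (vertexB T) lc.

Definition isometry (f : point -> point) : Prop :=
  forall P Q : point, point_dist (f P) (f Q) = point_dist P Q.

(* Label-respecting congruence; reflections are allowed. *)
Definition congruent (T T' : plane_triangle) : Prop :=
  exists f : point -> point,
    isometry f /\
    f (vertexA T) = vertexA T' /\
    f (vertexB T) = vertexB T' /\
    f (vertexC T) = vertexC T'.

(* Main.v *)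
Require Import Defs.
From Stdlib Require Import Reals Ranalysis5 Lra Psatz.
Open Scope R_scope.

(* With the Ravi coordinates [a = y + z], [b = z + x], [c = x + y] one has
   [l_a^2 = 4 (x + y + z) x (x + y) (x + z) / (2 x + y + z)^2]. The ratio
   [l_a^2 / l_c^2] is homogeneous of degree 0, and at fixed [y] it increases
   in [x] and decreases in [z].
   Uniqueness: if the coordinates of two solutions have ratios [k >= l >= m],
   then after scaling so that the coordinate of ratio [l] agrees, the quotient
   of the two extreme bisectors is strictly larger in one triangle than in the
   other unless [k = l = m]; homogeneity then forces the common ratio to be 1.
   Existence: normalize one coordinate to 1; one prescribed quotient makes the
   second a continuous function of the third, the other quotient is
   reached by the intermediate value theorem, and a final scaling adjusts the
   size. *)

(** * Squared bisectors in Ravi coordinates and monotonicity of their quotients *)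

Definition sq_bisector (x y z : R) : R :=
  4 * (x + y + z) * x * (x + y) * (x + z) / (2 * x + y + z) ^ 2.

(* The quotient of [sq_bisector u v w] by [sq_bisector v w u]. *)
Definition bisector_ratio (u v w : R) : R :=
  (u * (u + w) / (2 * u + v + w) ^ 2) *
  ((u + 2 * v + w) ^ 2 / (v * (v + w))).

Lemma sq_bisector_pos x y z :
  0 < x -> 0 < y -> 0 < z -> 0 < sq_bisector x y z.
Proof.
  intros hx hy hz; unfold sq_bisector.
  apply Rdiv_lt_0_compat; [| apply pow_lt; lra].
  repeat apply Rmult_lt_0_compat; lra.
Qed.

Lemma sq_bisector_sym x y z : sq_bisector x y z = sq_bisector x z y.
Proof.
  unfold sq_bisector.
  replace (2 * x + z + y) with (2 * x + y + z) by ring.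
  f_equal; ring.
Qed.

Lemma sq_bisector_scale k x y z :
  0 < k -> 0 < x -> 0 < y -> 0 < z ->
  sq_bisector (k * x) (k * y) (k * z) = k ^ 2 * sq_bisector x y z.
Proof.
  intros; unfold sq_bisector; field; split; nra.
Qed.

Lemma bisector_ratio_correct u v w :
  0 < u -> 0 < v -> 0 < w ->
  bisector_ratio u v w * sq_bisector v w u = sq_bisector u v w.
Proof.
  intros; unfold bisector_ratio, sq_bisector; field; repeat split; nra.
Qed.

Lemma bisector_ratio_scale k u v w :
  0 < k -> 0 < u -> 0 < v -> 0 < w ->
  bisector_ratio (k * u) (k * v) (k * w) = bisector_ratio u v w.
Proof.
  intros; unfold bisector_ratio; field; repeat split; nra.
Qed.

Lemma bisector_ratio_inv u v w :
  0 < u -> 0 < v -> 0 < w -> bisector_ratio u v w = / bisector_ratio v u w.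
Proof.
  intros; unfold bisector_ratio; field; repeat split; nra.
Qed.

Lemma bisector_ratio_pos u v w :
  0 < u -> 0 < v -> 0 < w -> 0 < bisector_ratio u v w.
Proof.
  intros; unfold bisector_ratio.
  apply Rmult_lt_0_compat; apply Rdiv_lt_0_compat;
    first [apply pow_lt; lra | apply Rmult_lt_0_compat; lra].
Qed.

Lemma Rdiv_lt_cross a b c d :
  0 < b -> 0 < d -> a * d < c * b -> a / b < c / d.
Proof.
  intros hb hd h.
  apply (Rmult_lt_reg_r (b * d)); [nra |].
  replace (a / b * (b * d)) with (a * d) by (field; lra).
  replace (c / d * (b * d)) with (c * b) by (field; lra).
  exact h.
Qed.

Lemma bisector_ratio_incr u u' v w :
  0 < u -> u < u' -> 0 < v -> 0 < w ->
  bisector_ratio u v w < bisector_ratio u' v w.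
Proof.
  intros hu huu' hv hw; unfold bisector_ratio.
  apply Rmult_gt_0_lt_compat.
  - apply Rdiv_lt_0_compat; [apply pow_lt; lra | nra].
  - apply Rdiv_lt_0_compat; [nra | apply pow_lt; lra].
  - apply Rdiv_lt_cross; try (apply pow_lt; lra).
    (* With [s = 2 u + w] one has [4 u (u + w) = s^2 - w^2], and
       [s / (s + v)] increases while [w / (s + v)] decreases. *)
    set (s := 2 * u + w); set (s' := 2 * u' + w).
    assert (hs : 0 < s) by (unfold s; lra).
    assert (hss : s < s') by (unfold s, s'; lra).
    replace (u * (u + w)) with ((s ^ 2 - w ^ 2) / 4) by (unfold s; field).
    replace (u' * (u' + w)) with ((s' ^ 2 - w ^ 2) / 4) by (unfold s'; field).
    replace (2 * u + v + w) with (s + v) by (unfold s; ring).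
    replace (2 * u' + v + w) with (s' + v) by (unfold s'; ring).
    assert (h1 : s * (s' + v) < s' * (s + v)) by nra.
    assert (h2 : (s * (s' + v)) ^ 2 < (s' * (s + v)) ^ 2)
      by ((simpl; rewrite !Rmult_1_r;
          apply Rmult_le_0_lt_compat; nra)).
    assert (h3 : (s + v) ^ 2 < (s' + v) ^ 2) by nra.
    assert (h4 : 0 < w ^ 2) by nra.
    nra.
  - unfold Rdiv; apply Rmult_lt_compat_r; [apply Rinv_0_lt_compat |]; nra.
Qed.

(** Exchanging the first two arguments inverts the ratio, which turns growth in the first into decay
    in the second. *)
Lemma bisector_ratio_decr u v v' w :
  0 < u -> 0 < v -> v < v' -> 0 < w ->
  bisector_ratio u v' w < bisector_ratio u v w.
Proof.
  intros.
  rewrite (bisector_ratio_inv u v'), (bisector_ratio_inv u v) by lra.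
  apply Rinv_lt_contravar.
  - apply Rmult_lt_0_compat; apply bisector_ratio_pos; lra.
  - apply bisector_ratio_incr; lra.
Qed.

(** * Existence of Ravi coordinates with prescribed bisectors *)

Lemma bisector_ratio_continuous (f g h : R -> R) (t : R) :
  continuity_pt f t -> continuity_pt g t -> continuity_pt h t ->
  0 < f t -> 0 < g t -> 0 < h t ->
  continuity_pt (fun s => bisector_ratio (f s) (g s) (h s)) t.
Proof.
  intros cf cg ch hf hg hh; unfold bisector_ratio.
  reg; repeat split; try assumption; nra.
Qed.

(** The ratio is [u / v] times [(u + w) / (v + w)] times the square of
    [(u + 2 v + w) / (2 u + v + w)]. For [u >= v] the last two factors are at least 1 and 1/4, so
    [u / v > 4 a] suffices. The bound is uniform in [w], which matters once [w] itself varies with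
    [v]. *)
Lemma bisector_ratio_large a u v w :
  0 < a -> 0 < v -> 0 < w -> u = (4 * a + 1) * v -> a < bisector_ratio u v w.
Proof.
  intros ha hv hw ->; unfold bisector_ratio.
  set (u := (4 * a + 1) * v).
  assert (huv : v <= u) by (unfold u; nra).
  replace (_ * _) with
    ((4 * a + 1) * (((u + w) / (v + w)) *
       ((u + 2 * v + w) / (2 * u + v + w)) ^ 2))
    by (unfold u; field; repeat split; nra).
  assert (h1 : 1 <= (u + w) / (v + w)).
  { apply (Rmult_le_reg_r (v + w)); [lra |].
    replace ((u + w) / (v + w) * (v + w)) with (u + w) by (field; lra); lra. }
  assert (h2 : / 2 <= (u + 2 * v + w) / (2 * u + v + w)).
  { apply (Rmult_le_reg_r (2 * u + v + w)); [lra |].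
    replace ((u + 2 * v + w) / (2 * u + v + w) * (2 * u + v + w))
      with (u + 2 * v + w) by (field; lra); lra. }
  assert (h3 : / 4 <= ((u + 2 * v + w) / (2 * u + v + w)) ^ 2) by nra.
  assert (h4 : / 4 <= (u + w) / (v + w) *
                 ((u + 2 * v + w) / (2 * u + v + w)) ^ 2) by nra.
  nra.
Qed.

Lemma bisector_ratio_small a u v w :
  0 < a -> 0 < u -> 0 < w -> v = (4 / a + 1) * u -> bisector_ratio u v w < a.
Proof.
  intros ha hu hw hv.
  assert (ha' : 0 < / a) by (apply Rinv_0_lt_compat; lra).
  assert (hv' : 0 < v) by (subst v; unfold Rdiv; nra).
  rewrite bisector_ratio_inv by assumption.
  rewrite <- (Rinv_inv a).
  apply Rinv_lt_contravar.
  - apply Rmult_lt_0_compat; [assumption | apply bisector_ratio_pos; assumption].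
  - apply bisector_ratio_large; auto.
Qed.

(** The root comes as a [sig], so that it can be turned into a function of [z] in
    [sq_bisectors_exist]. *)
Lemma bisector_ratio_solve (a z : R) :
  0 < a -> 0 < z -> {x : R | 0 < x /\ bisector_ratio x z 1 = a}.
Proof.
  intros ha hz.
  assert (ha' : 0 < / a) by (apply Rinv_0_lt_compat; lra).
  assert (hd : 0 < 4 / a + 1) by (unfold Rdiv; lra).
  (* The thresholds of [bisector_ratio_small] and [bisector_ratio_large]: the ratio is below [a] at
     [lo] and above [a] at [hi]. *)
  set (lo := z / (4 / a + 1)); set (hi := (4 * a + 1) * z).
  assert (hlo : 0 < lo) by (apply Rdiv_lt_0_compat; lra).
  assert (hloz : z = (4 / a + 1) * lo) by (unfold lo; field; lra).
  assert (hlt : lo < z) by (unfold Rdiv in hloz; nra).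
  assert (hhi : z < hi) by (unfold hi; nra).
  destruct (IVT_interv (fun x => bisector_ratio x z 1 - a) lo hi)
    as [x [hx ex]].
  - intros t ht; apply (continuity_pt_minus (fun x => bisector_ratio x z 1) (fun _ => a)); [| reg].
    apply (bisector_ratio_continuous (fun t => t) (fun _ => z) (fun _ => 1));
      try lra; reg.
  - lra.
  - assert (h := bisector_ratio_small a lo z 1 ha hlo Rlt_0_1 hloz); lra.
  - assert (h := bisector_ratio_large a hi z 1 ha hz Rlt_0_1 eq_refl); lra.
  - exists x; simpl in ex; split; lra.
Qed.

(* The solution is unique because the ratio is monotone; monotonicity in the
   other variable traps it near [X t] at all [s] near [t]. *)
Lemma implicit_continuous (a : R) (X : R -> R) (t : R) :
  0 < t ->
  (forall s, 0 < s -> 0 < X s /\ bisector_ratio (X s) s 1 = a) ->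
  continuity_pt X t.
Proof.
  intros ht hX.
  destruct (hX t ht) as [hXt eXt].
  assert (c : forall u, 0 < u ->
            continuity_pt (fun s => bisector_ratio u s 1) t).
  { intros u hu.
    apply (bisector_ratio_continuous (fun _ => u) (fun s => s) (fun _ => 1));
      try lra; reg. }
  intros eps heps.
  (* The bound [X t / 2] keeps [X t - e] positive, as the monotonicity lemmas require. *)
  set (e := Rmin (eps / 2) (X t / 2)).
  assert (he : 0 < e) by (apply Rmin_glb_lt; lra).
  assert (he1 : e <= eps / 2) by apply Rmin_l.
  assert (he2 : e <= X t / 2) by apply Rmin_r.
  assert (hlow : bisector_ratio (X t - e) t 1 < a)
    by (rewrite <- eXt; apply bisector_ratio_incr; lra).
  assert (hupp : a < bisector_ratio (X t + e) t 1)
    by (rewrite <- eXt; apply bisector_ratio_incr; lra).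
  destruct (c (X t - e) ltac:(lra) (a - bisector_ratio (X t - e) t 1)
              ltac:(lra)) as [d1 [hd1 H1]].
  destruct (c (X t + e) ltac:(lra) (bisector_ratio (X t + e) t 1 - a)
              ltac:(lra)) as [d2 [hd2 H2]].
  (* Including [t] in the radius keeps [s] positive. *)
  exists (Rmin t (Rmin d1 d2)); split.
  { repeat apply Rmin_glb_lt; lra. }
  intros s [hs hst].
  simpl in *; unfold R_dist in *.
  assert (m1 := Rmin_l t (Rmin d1 d2)); assert (m2 := Rmin_r t (Rmin d1 d2)).
  assert (m3 := Rmin_l d1 d2); assert (m4 := Rmin_r d1 d2).
  assert (n1 : Rabs (s - t) < d1) by lra.
  assert (n2 : Rabs (s - t) < d2) by lra.
  assert (H1' := Rabs_def2 _ _ (H1 s (conj hs n1))).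
  assert (H2' := Rabs_def2 _ _ (H2 s (conj hs n2))).
  assert (hs0 : 0 < s) by (apply Rabs_def2 in hst; lra).
  destruct (hX s hs0) as [hXs eXs].
  assert (X t - e < X s).
  { apply Rnot_le_lt; intros hle.
    assert (h : a <= bisector_ratio (X t - e) s 1).
    { rewrite <- eXs; destruct hle as [hle | ->]; [| lra].
      apply Rlt_le, bisector_ratio_incr; lra. }
    lra. }
  assert (X s < X t + e).
  { apply Rnot_le_lt; intros hle.
    assert (h : bisector_ratio (X t + e) s 1 <= a).
    { rewrite <- eXs; destruct hle as [hle | ->]; [| lra].
      apply Rlt_le, bisector_ratio_incr; lra. }
    lra. }
  apply Rabs_def1; lra.
Qed.

Lemma sq_bisectors_exist (A B C : R) :
  0 < A -> 0 < B -> 0 < C ->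
  exists x y z, 0 < x /\ 0 < y /\ 0 < z /\
    sq_bisector x y z = A /\ sq_bisector y z x = B /\ sq_bisector z x y = C.
Proof.
  intros hA hB hC.
  assert (ha : 0 < A / C) by (apply Rdiv_lt_0_compat; lra).
  assert (hb : 0 < B / C) by (apply Rdiv_lt_0_compat; lra).
  assert (eA : A = A / C * C) by (field; lra).
  assert (eB : B = B / C * C) by (field; lra).
  set (a := A / C) in *; set (b := B / C) in *; clearbody a b; subst A B.
  (* The curve on which the first quotient equals [a]; the value 0 at nonpositive [z] only makes the
     function total. *)
  set (X := fun z => match Rlt_dec 0 z with
                     | left h => proj1_sig (bisector_ratio_solve a z ha h)
                     | right _ => 0
                     end).
  assert (hX : forall s, 0 < s -> 0 < X s /\ bisector_ratio (X s) s 1 = a).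
  { intros s hs; unfold X; destruct (Rlt_dec 0 s) as [h |]; [| lra].
    exact (proj2_sig (bisector_ratio_solve a s ha h)). }
  assert (hb' : 0 < / b) by (apply Rinv_0_lt_compat; lra).
  assert (hlo : 0 < / (4 * b + 1)) by (apply Rinv_0_lt_compat; lra).
  assert (hlo1 : / (4 * b + 1) < 1)
    by (rewrite <- Rinv_1; apply Rinv_lt_contravar; lra).
  assert (hhi : 1 < 4 / b + 1) by (unfold Rdiv; lra).
  (* At the left end [1 = (4 b + 1) z] and the ratio exceeds [b]; at the right end it is below [b].
     Both bounds hold whatever the value of [X z]. *)
  destruct (IVT_interv (fun z => b - bisector_ratio 1 z (X z))
              (/ (4 * b + 1)) (4 / b + 1)) as [z [hz ez]].
  - intros t ht; apply (continuity_pt_minus (fun _ => b) (fun z => bisector_ratio 1 z (X z))); [reg |].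
    apply (bisector_ratio_continuous (fun _ => 1) (fun t => t) X);
      try lra; try reg; [| apply hX; lra].
    apply (implicit_continuous a); [lra | exact hX].
  - lra.
  - assert (h := bisector_ratio_large b 1 (/ (4 * b + 1)) (X (/ (4 * b + 1)))
                   hb hlo (proj1 (hX _ hlo)) ltac:(field; lra)); lra.
  - assert (hhi0 : 0 < 4 / b + 1) by lra.
    assert (hX1 := proj1 (hX _ hhi0)).
    assert (h := bisector_ratio_small b 1 (4 / b + 1) _
                   hb Rlt_0_1 hX1 ltac:(ring)); lra.
  - assert (hz0 : 0 < z) by lra.
    destruct (hX z hz0) as [hx ex]; set (x := X z) in *; simpl in ez.
    fold x in ez.
    assert (e1 := bisector_ratio_correct x z 1 hx hz0 Rlt_0_1).
    assert (e2 := bisector_ratio_correct 1 z x Rlt_0_1 hz0 hx).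
    rewrite (sq_bisector_sym z 1 x) in e1.
    rewrite (sq_bisector_sym x z 1) in e1.
    assert (hF := sq_bisector_pos z x 1 hz0 hx Rlt_0_1).
    rewrite (sq_bisector_sym 1 z x) in e2; rewrite (sq_bisector_sym 1 x z) in e2.
    set (F := sq_bisector z x 1) in *.
    (* The coordinates [x], 1, [z] have the right quotients. Scaling by [k] multiplies squared
       bisectors by [k ^ 2], so [k ^ 2 = C / F] corrects the size. *)
    set (k := sqrt (C / F)).
    assert (hk : 0 < k) by (apply sqrt_lt_R0, Rdiv_lt_0_compat; lra).
    assert (ek : k ^ 2 = C / F).
    { unfold k; simpl; rewrite Rmult_1_r; apply sqrt_sqrt.
      apply Rlt_le, Rdiv_lt_0_compat; lra. }
    exists (k * x), (k * 1), (k * z).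
    split; [nra |]; split; [nra |]; split; [nra |].
    rewrite !sq_bisector_scale by first [exact Rlt_0_1 | assumption].
    fold F; rewrite ek, <- e1, <- e2, ex.
    replace (bisector_ratio 1 z x) with b by lra.
    repeat split; field; lra.
Qed.

(** * Uniqueness of the Ravi coordinates *)

Lemma bisector_ratio_mono u u' v v' w :
  0 < u -> u <= u' -> 0 < v' -> v' <= v -> 0 < w ->
  bisector_ratio u v w = bisector_ratio u' v' w -> u = u' /\ v = v'.
Proof.
  (* Raising [u] and lowering [v] both increase the ratio, so a strict change in either contradicts
     [e]. *)
  intros hu [hu' | <-] hv [hv' | <-] hw e; try (split; reflexivity); exfalso.
  - assert (h1 := bisector_ratio_incr u u' v w hu hu' ltac:(lra) hw).
    assert (h2 := bisector_ratio_decr u' v' v w ltac:(lra) hv hv' hw); lra.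
  - assert (h1 := bisector_ratio_incr u u' v' w hu hu' hv hw); lra.
  - assert (h2 := bisector_ratio_decr u v' v w hu hv hv' hw); lra.
Qed.

Lemma sq_bisectors_ordered_inj k l m x y z :
  0 < x -> 0 < y -> 0 < z -> 0 < m -> m <= l -> l <= k ->
  sq_bisector x y z = sq_bisector (k * x) (l * y) (m * z) ->
  sq_bisector z x y = sq_bisector (m * z) (k * x) (l * y) ->
  k = 1 /\ l = 1 /\ m = 1.
Proof.
  intros hx hy hz hm hml hlk ex ez.
  assert (hkx : 0 < k * x) by nra; assert (hly : 0 < l * y) by nra.
  assert (hmz : 0 < m * z) by nra.
  assert (c1 := bisector_ratio_correct x z y hx hz hy).
  assert (c2 := bisector_ratio_correct (k * x) (m * z) (l * y) hkx hmz hly).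
  rewrite (sq_bisector_sym x z y), (sq_bisector_sym z y x) in c1.
  rewrite (sq_bisector_sym (k * x) (m * z)),
    (sq_bisector_sym (m * z) (l * y)) in c2.
  assert (hF := sq_bisector_pos x y z hx hy hz).
  assert (hG := sq_bisector_pos z x y hz hx hy).
  assert (e : bisector_ratio x z y = bisector_ratio (k * x) (m * z) (l * y)).
  { apply (Rmult_eq_reg_r (sq_bisector z x y)); [| lra].
    rewrite c1, ez, c2; exact ex. }
  (* Scaling the first triple by [l] makes the third argument [l * y] common to both sides, while
     [l * x <= k * x] and [m * z <= l * z]. *)
  rewrite <- (bisector_ratio_scale l x z y) in e by lra.
  apply bisector_ratio_mono in e; try nra.
  destruct e as [e1 e2].
  assert (l = k) by nra; assert (l = m) by nra; subst k m.
  (* The triples are now proportional with factor [l], so squared bisectors differ by [l ^ 2]. *)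
  rewrite sq_bisector_scale in ex by lra.
  assert (l ^ 2 = 1) by nra.
  assert (l = 1) by nra; auto.
Qed.

Lemma sq_bisectors_inj x y z x' y' z' :
  0 < x -> 0 < y -> 0 < z -> 0 < x' -> 0 < y' -> 0 < z' ->
  sq_bisector x y z = sq_bisector x' y' z' ->
  sq_bisector y z x = sq_bisector y' z' x' ->
  sq_bisector z x y = sq_bisector z' x' y' ->
  x = x' /\ y = y' /\ z = z'.
Proof.
  intros hx hy hz hx' hy' hz'.
  assert (hk : 0 < x' / x) by (apply Rdiv_lt_0_compat; lra).
  assert (hl : 0 < y' / y) by (apply Rdiv_lt_0_compat; lra).
  assert (hm : 0 < z' / z) by (apply Rdiv_lt_0_compat; lra).
  assert (ex : x' = x' / x * x) by (field; lra).
  assert (ey : y' = y' / y * y) by (field; lra).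
  assert (ez : z' = z' / z * z) by (field; lra).
  set (k := x' / x) in *; set (l := y' / y) in *; set (m := z' / z) in *.
  clearbody k l m; subst x' y' z'; intros Fx Fy Fz.
  (* [sq_bisectors_ordered_inj] uses a fixed cyclic order of the arguments; these mirrored equations
     serve the odd permutations. *)
  assert (Gx := Fx); assert (Gy := Fy); assert (Gz := Fz).
  rewrite (sq_bisector_sym x), (sq_bisector_sym (k * x)) in Gx.
  rewrite (sq_bisector_sym y), (sq_bisector_sym (l * y)) in Gy.
  rewrite (sq_bisector_sym z), (sq_bisector_sym (m * z)) in Gz.
  assert (h : k = 1 /\ l = 1 /\ m = 1).
  (* Of the eight outcomes two are cyclic and contradictory; the other six are the orderings of [k],
     [l], [m]. *)
  { destruct (Rle_lt_dec k l) as [a | a]; destruct (Rle_lt_dec l m) as [b | b];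
      destruct (Rle_lt_dec k m) as [c | c]; try lra.
    - destruct (sq_bisectors_ordered_inj m l k z y x) as [? [? ?]]; auto; lra.
    - destruct (sq_bisectors_ordered_inj l m k y z x) as [? [? ?]]; auto; lra.
    - destruct (sq_bisectors_ordered_inj l k m y x z) as [? [? ?]]; auto; lra.
    - destruct (sq_bisectors_ordered_inj m k l z x y) as [? [? ?]]; auto; lra.
    - destruct (sq_bisectors_ordered_inj k m l x z y) as [? [? ?]]; auto; lra.
    - destruct (sq_bisectors_ordered_inj k l m x y z) as [? [? ?]]; auto; lra. }
  destruct h as [-> [-> ->]]; repeat split; ring.
Qed.

(** * From Ravi coordinates to triangles *)

(** Twice the signed area of the triangle [VPQ]. *)
Definition cross (V P Q : point) : R :=
  (fst P - fst V) * (snd Q - snd V) - (snd P - snd V) * (fst Q - fst V).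

Definition dot (V P Q : point) : R :=
  (fst P - fst V) * (fst Q - fst V) + (snd P - snd V) * (snd Q - snd V).

Lemma point_dist_pos P Q : 0 <= point_dist P Q.
Proof. apply sqrt_pos. Qed.

Lemma point_dist_sqr P Q :
  point_dist P Q ^ 2 = (fst P - fst Q) ^ 2 + (snd P - snd Q) ^ 2.
Proof.
  unfold point_dist, dist_euc, Rsqr; simpl; rewrite !Rmult_1_r.
  apply sqrt_sqrt, Rplus_le_le_0_compat; apply Rle_0_sqr.
Qed.

Lemma point_dist_sym P Q : point_dist P Q = point_dist Q P.
Proof. apply distance_symm. Qed.

Lemma pow2_inj a b : 0 <= a -> 0 <= b -> a ^ 2 = b ^ 2 -> a = b.
Proof. intros; nra. Qed.

Lemma collinear_cross P Q S : collinear P Q S <-> cross P Q S = 0.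
Proof.
  unfold collinear, cross.
  destruct P as [p1 p2], Q as [q1 q2], S as [s1 s2]; simpl; split.
  - intros (a & b & c & hab & hP & hQ & hS).
    assert (h1 : a * (q1 - p1) + b * (q2 - p2) = 0) by lra.
    assert (h2 : a * (s1 - p1) + b * (s2 - p2) = 0) by lra.
    destruct hab as [h | h]; apply (Rmult_eq_reg_l _ _ _) with (2 := h);
      rewrite Rmult_0_r.
    + replace (a * _) with
        (a * (q1 - p1) * (s2 - p2) - (q2 - p2) * (a * (s1 - p1))) by ring.
      replace (a * (q1 - p1)) with (- (b * (q2 - p2))) by lra.
      replace (a * (s1 - p1)) with (- (b * (s2 - p2))) by lra; ring.
    + replace (b * _) with
        ((q1 - p1) * (b * (s2 - p2)) - b * (q2 - p2) * (s1 - p1)) by ring.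
      replace (b * (q2 - p2)) with (- (a * (q1 - p1))) by lra.
      replace (b * (s2 - p2)) with (- (a * (s1 - p1))) by lra; ring.
  (* The line is [PQ] if these points differ; otherwise it is the horizontal through [P] when [S]
     lies on it, and [PS] when not. *)
  - intros h.
    destruct (Req_dec q2 p2) as [e2 | n2];
      [destruct (Req_dec q1 p1) as [e1 | n1] |].
    + destruct (Req_dec s2 p2) as [f2 | m2].
      * exists 0, 1, p2; repeat split; try lra.
      * exists (s2 - p2), (- (s1 - p1)), ((s2 - p2) * p1 - (s1 - p1) * p2).
        repeat split; subst; try lra.
    + exists (q2 - p2), (- (q1 - p1)), ((q2 - p2) * p1 - (q1 - p1) * p2).
      repeat split; try lra.
    + exists (q2 - p2), (- (q1 - p1)), ((q2 - p2) * p1 - (q1 - p1) * p2).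
      repeat split; try lra.
Qed.

(** Lagrange's identity, the source of the Cauchy-Schwarz bounds below and of their strictness for
    non-collinear points. *)
Lemma dot_cross_sqr V P Q :
  dot V P Q ^ 2 + cross V P Q ^ 2 = (point_dist P V * point_dist Q V) ^ 2.
Proof.
  rewrite Rpow_mult_distr, !point_dist_sqr; unfold dot, cross; ring.
Qed.

Lemma dot_bound V P Q :
  - (point_dist P V * point_dist Q V) <= dot V P Q
    <= point_dist P V * point_dist Q V.
Proof.
  assert (h := dot_cross_sqr V P Q).
  assert (h0 := Rmult_le_pos _ _ (point_dist_pos P V) (point_dist_pos Q V)).
  set (n := point_dist P V * point_dist Q V) in *; nra.
Qed.

Lemma dot_bound_strict V P Q :
  cross V P Q <> 0 ->
  - (point_dist P V * point_dist Q V) < dot V P Q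
    < point_dist P V * point_dist Q V.
Proof.
  intros hc.
  assert (h := dot_cross_sqr V P Q).
  assert (h0 := Rmult_le_pos _ _ (point_dist_pos P V) (point_dist_pos Q V)).
  assert (0 < cross V P Q ^ 2) by nra.
  set (n := point_dist P V * point_dist Q V) in *; nra.
Qed.

Lemma dot_law_of_cosines V P Q :
  2 * dot V P Q =
    point_dist P V ^ 2 + point_dist Q V ^ 2 - point_dist P Q ^ 2.
Proof. rewrite !point_dist_sqr; unfold dot; ring. Qed.

Lemma point_dist_pos_of_cross V P Q :
  cross V P Q <> 0 -> 0 < point_dist P V /\ 0 < point_dist Q V.
Proof.
  intros hc.
  assert (h := dot_bound_strict V P Q hc).
  assert (h1 := point_dist_pos P V); assert (h2 := point_dist_pos Q V).
  split; nra.
Qed.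

Lemma triangle_inequality_strict V P Q :
  cross V P Q <> 0 -> point_dist P Q < point_dist P V + point_dist Q V.
Proof.
  intros hc.
  assert (h := dot_bound_strict V P Q hc).
  assert (e := dot_law_of_cosines V P Q).
  assert (h1 := point_dist_pos P V); assert (h2 := point_dist_pos Q V).
  assert (h3 := point_dist_pos P Q).
  nra.
Qed.

(** Cauchy-Schwarz puts both cosines in [-1, 1], where [cos] undoes [acos]; the common length of
    [DV] then cancels. *)
Lemma angle_eq_iff V P D Q :
  0 < point_dist P V -> 0 < point_dist D V -> 0 < point_dist Q V ->
  angle P V D = angle D V Q <->
  dot V P D * point_dist Q V = dot V D Q * point_dist P V.
Proof.
  intros hP hD hQ; unfold angle; fold (dot V P D) (dot V D Q).
  assert (b1 := dot_bound V P D); assert (b2 := dot_bound V D Q).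
  assert (bound : forall d n, 0 < n -> - n <= d <= n -> -1 <= d / n <= 1).
  { intros d n hn hd.
    replace d with (d / n * n) in hd by (field; lra); split; nra. }
  assert (e1 : dot V P D * point_dist Q V =
    dot V P D / (point_dist P V * point_dist D V) *
    (point_dist P V * point_dist D V * point_dist Q V)) by (field; lra).
  assert (e2 : dot V D Q * point_dist P V =
    dot V D Q / (point_dist D V * point_dist Q V) *
    (point_dist P V * point_dist D V * point_dist Q V)) by (field; lra).
  rewrite e1, e2; split.
  - intros e; apply (f_equal cos) in e.
    rewrite !cos_acos in e
      by (apply bound; [apply Rmult_lt_0_compat |]; assumption).
    rewrite e; reflexivity.
  - intros e; f_equal.
    apply Rmult_eq_reg_r in e; [exact e |].
    apply Rgt_not_eq; repeat apply Rmult_lt_0_compat; assumption.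
Qed.

(** The classical [b c (1 - (a / (b + c))^2)] for the squared bisector onto the side [a]. *)
Definition sq_bisector_sides (a b c : R) : R :=
  b * c * ((b + c) ^ 2 - a ^ 2) / (b + c) ^ 2.

(** Writing the foot as [(1 - t) P + t Q], equality of the angles amounts to [(1 - t) p = t q], the
    angle bisector theorem. This fixes [t = p / (p + q)], and expanding the squared length gives the
    formula. *)
Lemma bisector_length_iff V P Q l :
  cross V P Q <> 0 ->
  bisector_length V P Q l <->
  0 <= l /\ l ^ 2 =
    sq_bisector_sides (point_dist P Q) (point_dist P V) (point_dist Q V).
Proof.
  intros hc.
  destruct (point_dist_pos_of_cross V P Q hc) as [hP hQ].
  assert (hb := dot_bound_strict V P Q hc).
  assert (eP := point_dist_sqr P V); assert (eQ := point_dist_sqr Q V).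
  assert (ea := dot_law_of_cosines V P Q).
  set (p := point_dist P V) in *; set (q := point_dist Q V) in *.
  set (d := dot V P Q) in *.
  assert (pos : forall t, 0 <= t <= 1 ->
            0 < (1 - t) ^ 2 * p ^ 2 + 2 * t * (1 - t) * d + t ^ 2 * q ^ 2).
  { intros t ht.
    destruct (Req_dec t 0) as [-> | n0]; [nra |].
    destruct (Req_dec t 1) as [-> | n1]; [nra |].
    assert (0 < t * (1 - t)) by nra.
    (* Since [d > - p q], the expression exceeds [((1 - t) p - t q)^2]. *)
    assert (t * (1 - t) * - (p * q) < t * (1 - t) * d) by nra.
    assert (h := Rle_0_sqr ((1 - t) * p - t * q)); unfold Rsqr in h; nra. }
  assert (foot : forall D t, 0 <= t <= 1 ->
            fst D = (1 - t) * fst P + t * fst Q ->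
            snd D = (1 - t) * snd P + t * snd Q ->
            point_dist V D ^ 2 =
              (1 - t) ^ 2 * p ^ 2 + 2 * t * (1 - t) * d + t ^ 2 * q ^ 2 /\
            (angle P V D = angle D V Q <-> (1 - t) * p = t * q)).
  { intros D t ht e1 e2.
    assert (eD : point_dist V D ^ 2 =
              (1 - t) ^ 2 * p ^ 2 + 2 * t * (1 - t) * d + t ^ 2 * q ^ 2).
    { rewrite point_dist_sqr, e1, e2, eP, eQ; unfold d, dot; ring. }
    split; [exact eD |].
    assert (hD : 0 < point_dist D V).
    { rewrite point_dist_sym.
      assert (h1 := pos t ht); assert (h2 := point_dist_pos V D); nra. }
    rewrite angle_eq_iff by assumption; fold p q.
    replace (dot V P D) with ((1 - t) * p ^ 2 + t * d)
      by (unfold d, dot; rewrite e1, e2, eP; ring).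
    replace (dot V D Q) with ((1 - t) * d + t * q ^ 2)
      by (unfold d, dot; rewrite e1, e2, eQ; ring).
    (* The factor [p q - d] is positive by strict Cauchy-Schwarz and can be cancelled. *)
    assert (e : ((1 - t) * p ^ 2 + t * d) * q - ((1 - t) * d + t * q ^ 2) * p =
              (p * q - d) * ((1 - t) * p - t * q)) by ring.
    split; intros h.
    - apply Rminus_diag_uniq, (Rmult_eq_reg_l (p * q - d)); lra.
    - apply Rminus_diag_uniq; rewrite e, h; ring. }
  assert (val : forall t, (1 - t) * p = t * q ->
            (1 - t) ^ 2 * p ^ 2 + 2 * t * (1 - t) * d + t ^ 2 * q ^ 2 =
            sq_bisector_sides (point_dist P Q) p q).
  { intros t ht.
    assert (t = p / (p + q)) as ->
      by (apply (Rmult_eq_reg_r (p + q)); [field_simplify; lra | lra]).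
    unfold sq_bisector_sides.
    replace (point_dist P Q ^ 2) with (p ^ 2 + q ^ 2 - 2 * d) by lra.
    field; lra. }
  split.
  - intros (D & ((t & ht & e1 & e2) & hang) & <-).
    split; [apply point_dist_pos |].
    destruct (foot D t ht e1 e2) as [-> h].
    apply val, h, hang.
  - intros [hl el].
    set (t := p / (p + q)).
    assert (htt : (1 - t) * p = t * q) by (unfold t; field; lra).
    assert (ht : 0 <= t <= 1).
    { assert (t * (p + q) = p) by (unfold t; field; lra); split; nra. }
    set (D := ((1 - t) * fst P + t * fst Q, (1 - t) * snd P + t * snd Q)).
    exists D.
    destruct (foot D t ht eq_refl eq_refl) as [hd hang].
    split.
    + split; [exists t; auto | apply hang, htt].
    + apply pow2_inj; [apply point_dist_pos | exact hl |].
      rewrite hd, el; apply val, htt.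
Qed.

(** * Triangles from their sides: congruence and construction *)

Lemma congruent_of_sides (T T' : plane_triangle) :
  point_dist (vertexB T) (vertexC T) = point_dist (vertexB T') (vertexC T') ->
  point_dist (vertexC T) (vertexA T) = point_dist (vertexC T') (vertexA T') ->
  point_dist (vertexA T) (vertexB T) = point_dist (vertexA T') (vertexB T') ->
  congruent T T'.
Proof.
  destruct T as [A B C hT], T' as [A' B' C' hT']; unfold congruent; simpl.
  intros ha hb hc.
  rewrite collinear_cross in hT, hT'.
  rewrite (point_dist_sym A), (point_dist_sym A') in hc.
  (* With equal sides and equal inner products at [A], the two frames have the same Gram matrix,
     which makes the affine map below an isometry. *)
  assert (edot : dot A B C = dot A' B' C').
  { assert (h := dot_law_of_cosines A B C).
    assert (h' := dot_law_of_cosines A' B' C').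
    rewrite ha, hb, hc in h; lra. }
  apply (f_equal (fun r => r ^ 2)) in ha, hb, hc.
  rewrite !point_dist_sqr in hb, hc.
  (* The coordinates of a point in the frame [A; B - A, C - A] are
     transported to the frame [A'; B' - A', C' - A']. *)
  exists (fun X =>
    (fst A' + cross A X C / cross A B C * (fst B' - fst A')
            + cross A B X / cross A B C * (fst C' - fst A'),
     snd A' + cross A X C / cross A B C * (snd B' - snd A')
            + cross A B X / cross A B C * (snd C' - snd A'))).
  split; [| repeat split].
  - intros X Y; apply pow2_inj; try apply point_dist_pos.
    rewrite !point_dist_sqr; simpl.
    (* By Cramer's rule [u] and [v] are the coordinates of [X - Y] in the frame [B - A], [C - A]. *)
    set (u := (cross A X C - cross A Y C) / cross A B C).
    set (v := (cross A B X - cross A B Y) / cross A B C).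
    transitivity
      (u ^ 2 * ((fst B' - fst A') ^ 2 + (snd B' - snd A') ^ 2)
       + 2 * u * v * dot A' B' C'
       + v ^ 2 * ((fst C' - fst A') ^ 2 + (snd C' - snd A') ^ 2)).
    { unfold u, v, dot; field; assumption. }
    rewrite <- hb, <- hc, <- edot.
    assert (e1 : fst X - fst Y =
              u * (fst B - fst A) + v * (fst C - fst A)).
    { unfold u, v; apply (Rmult_eq_reg_r (cross A B C)); [| assumption].
      field_simplify; [| assumption]; unfold cross; ring. }
    assert (e2 : snd X - snd Y =
              u * (snd B - snd A) + v * (snd C - snd A)).
    { unfold u, v; apply (Rmult_eq_reg_r (cross A B C)); [| assumption].
      field_simplify; [| assumption]; unfold cross; ring. }
    rewrite e1, e2; unfold dot; ring.
  - replace (cross A A C) with 0 by (unfold cross; ring).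
    replace (cross A B A) with 0 by (unfold cross; ring).
    destruct A'; simpl; f_equal; field; assumption.
  - replace (cross A B B) with 0 by (unfold cross; ring).
    destruct B'; simpl; f_equal; field; assumption.
  - replace (cross A C C) with 0 by (unfold cross; ring).
    destruct C'; simpl; f_equal; field; assumption.
Qed.

Lemma triangle_of_sides (a b c : R) :
  0 < a -> 0 < b -> 0 < c -> a < b + c -> b < c + a -> c < a + b ->
  exists T : plane_triangle,
    point_dist (vertexB T) (vertexC T) = a /\
    point_dist (vertexC T) (vertexA T) = b /\
    point_dist (vertexA T) (vertexB T) = c.
Proof.
  intros ha hb hc h1 h2 h3.
  (* The triangle is placed at [(0, 0)], [(c, 0)], [(u, v)]; the law of cosines gives [u]. *)
  set (u := (b ^ 2 + c ^ 2 - a ^ 2) / (2 * c)).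
  assert (eu : 2 * c * u = b ^ 2 + c ^ 2 - a ^ 2) by (unfold u; field; lra).
  assert (hu : 0 < b ^ 2 - u ^ 2).
  { apply (Rmult_lt_reg_l (4 * c ^ 2)); [nra |].
    (* Heron's formula: both sides are 16 times the squared area. *)
    replace (4 * c ^ 2 * (b ^ 2 - u ^ 2)) with
      (((b + c) ^ 2 - a ^ 2) * (a ^ 2 - (b - c) ^ 2))
      by (replace (4 * c ^ 2 * (b ^ 2 - u ^ 2)) with
            (4 * c ^ 2 * b ^ 2 - (2 * c * u) ^ 2) by ring; rewrite eu; ring).
    rewrite Rmult_0_r; apply Rmult_lt_0_compat; nra. }
  set (v := sqrt (b ^ 2 - u ^ 2)).
  assert (hv : 0 < v) by (apply sqrt_lt_R0; exact hu).
  assert (ev : v ^ 2 = b ^ 2 - u ^ 2)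
    by (apply pow2_sqrt; lra).
  assert (nd : ~ collinear (0, 0) (c, 0) (u, v)).
  { rewrite collinear_cross; unfold cross; simpl; nra. }
  exists (PlaneTriangle _ _ _ nd); simpl.
  repeat split; (apply pow2_inj; [apply point_dist_pos | lra |]);
    rewrite point_dist_sqr; simpl fst; simpl snd; nra.
Qed.

Definition ravi (T : plane_triangle) (x y z : R) : Prop :=
  0 < x /\ 0 < y /\ 0 < z /\
  point_dist (vertexB T) (vertexC T) = y + z /\
  point_dist (vertexC T) (vertexA T) = z + x /\
  point_dist (vertexA T) (vertexB T) = x + y.

Lemma ravi_exists (T : plane_triangle) : exists x y z, ravi T x y z.
Proof.
  destruct T as [A B C hT]; unfold ravi; simpl.
  rewrite collinear_cross in hT.
  assert (hB : cross B C A <> 0) by (unfold cross in *; lra).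
  assert (hC : cross C A B <> 0) by (unfold cross in *; lra).
  apply triangle_inequality_strict in hT, hB, hC.
  rewrite (point_dist_sym B A) in *; rewrite (point_dist_sym A C) in *;
    rewrite (point_dist_sym C B) in *.
  set (a := point_dist B C) in *; set (b := point_dist C A) in *;
    set (c := point_dist A B) in *.
  (* The tangent lengths from the vertices to the incircle, positive by the triangle
     inequalities. *)
  exists ((b + c - a) / 2), ((c + a - b) / 2), ((a + b - c) / 2).
  repeat split; lra.
Qed.

(** In Ravi coordinates [(b + c)^2 - a^2 = 4 x (x + y + z)], so the side formula becomes
    [sq_bisector]; positivity lets squares stand for lengths. *)
Lemma has_bisectors_ravi (T : plane_triangle) x y z la lb lc :
  ravi T x y z -> 0 < la -> 0 < lb -> 0 < lc ->
  has_bisectors T la lb lc <->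
  sq_bisector x y z = la ^ 2 /\ sq_bisector y z x = lb ^ 2 /\
  sq_bisector z x y = lc ^ 2.
Proof.
  destruct T as [A B C hT]; unfold ravi, has_bisectors; simpl.
  rewrite collinear_cross in hT.
  assert (hB : cross B C A <> 0) by (unfold cross in *; lra).
  assert (hC : cross C A B <> 0) by (unfold cross in *; lra).
  intros (hx & hy & hz & ea & eb & ec) hla hlb hlc.
  rewrite !bisector_length_iff by assumption.
  rewrite (point_dist_sym B A), (point_dist_sym A C), (point_dist_sym C B).
  rewrite ea, eb, ec.
  assert (e : forall x y z, 0 < x -> 0 < y -> 0 < z ->
    sq_bisector_sides (y + z) (x + y) (z + x) = sq_bisector x y z).
  { intros; unfold sq_bisector_sides, sq_bisector; field; repeat split; lra. }
  rewrite !e by assumption.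
  assert (0 <= la) by lra; assert (0 <= lb) by lra; assert (0 <= lc) by lra.
  intuition.
Qed.

Theorem mainTheorem13 (l1 l2 : R) (hl2 : 0 < l2) (hl : l2 <= l1)
    (x : R) (hx : 0 < x) :
  exists T : plane_triangle,
    has_bisectors T l2 l1 x /\
    forall T' : plane_triangle, has_bisectors T' l2 l1 x -> congruent T T'.
Proof.
  assert (hl1 : 0 < l1) by lra.
  destruct (sq_bisectors_exist (l2 ^ 2) (l1 ^ 2) (x ^ 2))
    as (u & v & w & hu & hv & hw & eu & ev & ew); try (apply pow_lt; lra).
  destruct (triangle_of_sides (v + w) (w + u) (u + v))
    as (T & ha & hb & hc); try lra.
  exists T; split.
  - apply (has_bisectors_ravi T u v w); unfold ravi; auto 7.
  - intros T' h'.
    destruct (ravi_exists T') as (u' & v' & w' & r').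
    apply (has_bisectors_ravi T' u' v' w') in h'; try assumption.
    destruct r' as (hu' & hv' & hw' & ha' & hb' & hc').
    destruct h' as (eu' & ev' & ew').
    destruct (sq_bisectors_inj u v w u' v' w') as (<- & <- & <-);
      try assumption; try congruence.
    apply congruent_of_sides; congruence.
Qed.
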